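(* (i) The timelike general rotational surface of first type $\mathcal{M}_1$ has non-zero constant mean curvature if and only if, up to parametrization, the meridian curve is determined by $c: x(u)=(f(u),0,0,u)$, where $f(u)$ is a solution to the differential equation $$\left(\ln\left|\frac{1+f'}{1-f'}\right|\right)' = -2\,\frac{\alpha^2 f+\beta^2 u f'}{\alpha^2 f^2+\beta^2u^2}+2c\sqrt{1-f'^2},\quad c\neq0.$$ (ii) The timelike general rotational surface of second type $\mathcal{M}_2$ has non-zero constant mean curvature if and only if, up to parametrization, the meridian curve is determined by $c: x(u)=(f(u),0,u,0)$, where $f(u)$ is a solution to the differential equation $$(\arctan f')' = \frac{\alpha^2 f+\beta^2 u f'}{\alpha^2f^2-\beta^2u^2}+c\sqrt{1+f'^2},\quad c\neq0.$$
   Context: $\mathbb{R}^4_1$ is the four-dimensional Minkowski space, i.e. $\mathbb{R}^4$ with the flat metric $\langle\cdot,\cdot\rangle = dx_1^2+dx_2^2+dx_3^2-dx_4^2$. A surface in it is timelike if the induced metric has index 1. Let $J\subset\mathbb{R}$ be an interval, $f,g$ smooth functions on $J$, $\alpha,\beta$ positive constants, $u\in J$, $v\in[0,2\pi)$; a prime denotes $d/du$. Timelike general rotational surface of first type: $$\mathcal{M}_1: z(u,v)=(f(u)\cos\alpha v,\ f(u)\sin\alpha v,\ g(u)\sinh\beta v,\ g(u)\cosh\beta v),$$ where $f'^2-g'^2<0$ and $\alpha^2f^2+\beta^2g^2>0$. Its meridian curve is $c: x(u)=(f(u),0,0,g(u))$. Timelike general rotational surface of second type: $$\mathcal{M}_2: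 z(u,v)=(f(u)\cos\alpha v,\ f(u)\sin\alpha v,\ g(u)\cosh\beta v,\ g(u)\sinh\beta v),$$ where $\alpha^2f^2-\beta^2g^2<0$ and $f'^2+g'^2>0$. Its meridian curve is $c: x(u)=(f(u),0,g(u),0)$. (In the differential equations $c$ denotes a real constant, unrelated to the name $c$ of the curve.) Standing assumption: all surfaces are free of inflection points. This means that, for an orthonormal normal frame $\{n_1,n_2\}$ and $c_{11}^k=\langle z_{uu},n_k\rangle$, $c_{12}^k=\langle z_{uv},n_k\rangle$, $c_{22}^k=\langle z_{vv},n_k\rangle$ ($k=1,2$), the three determinants $\Delta_1=c_{11}^1c_{12}^2-c_{12}^1c_{11}^2$, $\Delta_2=c_{11}^1c_{22}^2-c_{22}^1c_{11}^2$, $\Delta_3=c_{12}^1c_{22}^2-c_{22}^1c_{12}^2$ do not all vanish at any point. The second fundamental tensor $\sigma(x,y)$ is the normal component of $\widetilde\nabla_xy$ for $x,y$ tangent ($\widetilde\nabla$ the Levi-Civita connection of $\mathbb{R}^4_1$), and the mean curvature vector field is $H=\tfrac12\operatorname{tr}\sigma$ (trace with respect to the induced metric). A surface has non-zero constant mean curvature if $\langle H,H\rangle=const\neq0$.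
   Formalization: In (ii) the equivalence is stated for g' without zeros on J, since M_2 of non-zero constant mean curvature can have g'=0 at isolated points, where the meridian is no graph (f(u),0,u,0); in general it is stated piecewise where g' is non-zero, densely in J, with c up to sign. *)

(* Defs.v *)
(* Stdlib reals and Coquelicot. *)
From Stdlib Require Import Reals Lra.
From Coquelicot Require Import Coquelicot.
Open Scope R_scope.

(** ** Minkowski space *)

(* The linear structure on [R41] (operations [plus], [minus], [scal]) is
   Coquelicot's product structure. *)
Definition R41 : Type := (R * R * R * R)%type.

Definition mink (x y : R41) : R :=
  let '(x1, x2, x3, x4) := x in
  let '(y1, y2, y3, y4) := y in
  x1 * y1 + x2 * y2 + x3 * y3 - x4 * y4.

Definition Derive4 (w : R -> R41) (t : R) : R41 :=
  (Derive (fun s => fst (fst (fst (w s)))) t,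
   Derive (fun s => snd (fst (fst (w s)))) t,
   Derive (fun s => snd (fst (w s))) t,
   Derive (fun s => snd (w s)) t).

(** ** Intervals, smoothness, changes of parameter *)

(* Any interval, open or not, bounded or not, with more than one point. *)
Definition is_interval (J : R -> Prop) : Prop :=
  (exists a b, a < b /\ J a /\ J b) /\
  (forall a b x, J a -> J b -> a <= x <= b -> J x).

(* Smoothness on a possibly non-open set means smoothness on an open
   neighbourhood, so that the two-sided derivatives at endpoints of [J] that
   belong to [J] are meaningful and depend only on the values on [J]. *)
Definition smooth_on (J : R -> Prop) (f : R -> R) : Prop :=
  exists U : R -> Prop,
    open U /\ (forall x, J x -> U x) /\
    (forall (n : nat) x, U x -> ex_derive_n f n x).

(* [phi : J' -> J] is a smooth change of parameter; injectivity follows from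
   [Derive phi <> 0] on the interval [J']. *)
Definition change_of_parameter (J' J : R -> Prop) (phi : R -> R) : Prop :=
  smooth_on J' phi /\
  (forall u, J' u -> Derive phi u <> 0) /\
  (forall u, J' u -> J (phi u)) /\
  (forall t, J t -> exists u, J' u /\ phi u = t).

(** ** Surfaces: fundamental forms and mean curvature *)

Definition surface : Type := R -> R -> R41.

Definition du (z : surface) : surface := fun u v => Derive4 (fun s => z s v) u.
Definition dv (z : surface) : surface := fun u v => Derive4 (fun s => z u s) v.

Definition gE (z : surface) (u v : R) : R := mink (du z u v) (du z u v).
Definition gF (z : surface) (u v : R) : R := mink (du z u v) (dv z u v).
Definition gG (z : surface) (u v : R) : R := mink (dv z u v) (dv z u v).
Definition gdet (z : surface) (u v : R) : R :=
  gE z u v * gG z u v - gF z u v ^ 2.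

(* Orthogonal projection on the tangent plane, in terms of the inverse Gram
   matrix of [du z u v], [dv z u v]. *)
Definition tangent_part (z : surface) (u v : R) (w : R41) : R41 :=
  let a := mink w (du z u v) in
  let b := mink w (dv z u v) in
  plus (scal ((gG z u v * a - gF z u v * b) / gdet z u v) (du z u v))
       (scal ((gE z u v * b - gF z u v * a) / gdet z u v) (dv z u v)).

Definition normal_part (z : surface) (u v : R) (w : R41) : R41 :=
  minus w (tangent_part z u v w).

Lemma mink_plus_l (x y w : R41) : mink (plus x y) w = mink x w + mink y w.
Proof.
destruct x as [[[x1 x2] x3] x4], y as [[[y1 y2] y3] y4], w as [[[w1 w2] w3] w4].
cbn; ring.
Qed.

Lemma mink_scal_l (a : R) (x w : R41) : mink (scal a x) w = a * mink x w.
Proof.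
destruct x as [[[x1 x2] x3] x4], w as [[[w1 w2] w3] w4].
cbn; unfold mult; cbn; ring.
Qed.

Lemma mink_minus_l (x y w : R41) : mink (minus x y) w = mink x w - mink y w.
Proof.
destruct x as [[[x1 x2] x3] x4], y as [[[y1 y2] y3] y4], w as [[[w1 w2] w3] w4].
cbn; ring.
Qed.

Lemma mink_sym (x y : R41) : mink x y = mink y x.
Proof.
destruct x as [[[x1 x2] x3] x4], y as [[[y1 y2] y3] y4]; cbn; ring.
Qed.

Lemma normal_part_orthogonal (z : surface) (u v : R) (w : R41) :
  gdet z u v <> 0 ->
  mink (normal_part z u v w) (du z u v) = 0 /\
  mink (normal_part z u v w) (dv z u v) = 0.
Proof.
intros Hd; unfold normal_part, tangent_part.
rewrite !mink_minus_l, !mink_plus_l, !mink_scal_l.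
rewrite (mink_sym (dv z u v) (du z u v)).
fold (gE z u v) (gF z u v) (gG z u v).
unfold gdet in *; split; field; exact Hd.
Qed.

(* [sigma (x, y)] for the tangent vectors [x = x.1 z_u + x.2 z_v] and
   [y = y.1 z_u + y.2 z_v]: the Levi-Civita connection of the ambient space is
   the ordinary derivative, and the derivatives of the coefficients of [y] only
   contribute tangentially. *)
Definition second_ff (z : surface) (u v : R) (x y : R * R) : R41 :=
  normal_part z u v
    (plus (plus (scal (fst x * fst y) (du (du z) u v))
                (scal (fst x * snd y + snd x * fst y) (dv (du z) u v)))
          (scal (snd x * snd y) (dv (dv z) u v))).

(* Half the trace of [second_ff] with respect to the induced metric. *)
Definition mean_curvature_vector (z : surface) (u v : R) : R41 :=
  let s11 := second_ff z u v (1, 0) (1, 0) in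
  let s12 := second_ff z u v (1, 0) (0, 1) in
  let s22 := second_ff z u v (0, 1) (0, 1) in
  scal (/ 2)
    (plus (plus (scal (gG z u v / gdet z u v) s11)
                (scal (- 2 * gF z u v / gdet z u v) s12))
          (scal (gE z u v / gdet z u v) s22)).

(* The parameter domain is [J x [0, 2 PI)]. *)
Definition nonzero_constant_mean_curvature (J : R -> Prop) (z : surface) : Prop :=
  exists k, k <> 0 /\
    forall u v, J u -> 0 <= v < 2 * PI ->
      mink (mean_curvature_vector z u v) (mean_curvature_vector z u v) = k.

(* The normal plane of a timelike surface is spacelike, hence the
   normalisation [1] of both normal vectors. *)
Definition orthonormal_normal_frame (z : surface) (u v : R) (n1 n2 : R41) : Prop :=
  mink n1 n1 = 1 /\ mink n2 n2 = 1 /\ mink n1 n2 = 0 /\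
  mink n1 (du z u v) = 0 /\ mink n1 (dv z u v) = 0 /\
  mink n2 (du z u v) = 0 /\ mink n2 (dv z u v) = 0.

Definition free_of_inflection_points (J : R -> Prop) (z : surface) : Prop :=
  forall u v n1 n2, J u -> 0 <= v < 2 * PI ->
    orthonormal_normal_frame z u v n1 n2 ->
    let c11 n := mink (du (du z) u v) n in
    let c12 n := mink (dv (du z) u v) n in
    let c22 n := mink (dv (dv z) u v) n in
    let Delta1 := c11 n1 * c12 n2 - c12 n1 * c11 n2 in
    let Delta2 := c11 n1 * c22 n2 - c22 n1 * c11 n2 in
    let Delta3 := c12 n1 * c22 n2 - c22 n1 * c12 n2 in
    ~ (Delta1 = 0 /\ Delta2 = 0 /\ Delta3 = 0).

(** ** The two types of timelike general rotational surfaces *)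

Definition M1 (f g : R -> R) (alpha beta : R) : surface := fun u v =>
  (f u * cos (alpha * v), f u * sin (alpha * v),
   g u * sinh (beta * v), g u * cosh (beta * v)).

Definition M1_conditions (J : R -> Prop) (f g : R -> R) (alpha beta : R) : Prop :=
  forall u, J u ->
    Derive f u ^ 2 - Derive g u ^ 2 < 0 /\
    alpha ^ 2 * f u ^ 2 + beta ^ 2 * g u ^ 2 > 0.

Definition meridian1 (f g : R -> R) (u : R) : R41 := (f u, 0, 0, g u).

Definition M2 (f g : R -> R) (alpha beta : R) : surface := fun u v =>
  (f u * cos (alpha * v), f u * sin (alpha * v),
   g u * cosh (beta * v), g u * sinh (beta * v)).

Definition M2_conditions (J : R -> Prop) (f g : R -> R) (alpha beta : R) : Prop :=
  forall u, J u ->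
    alpha ^ 2 * f u ^ 2 - beta ^ 2 * g u ^ 2 < 0 /\
    Derive f u ^ 2 + Derive g u ^ 2 > 0.

Definition meridian2 (f g : R -> R) (u : R) : R41 := (f u, 0, g u, 0).

(** ** The differential equations *)

Definition ode1 (alpha beta c : R) (f : R -> R) (u : R) : Prop :=
  Derive (fun t => ln (Rabs ((1 + Derive f t) / (1 - Derive f t)))) u =
  - 2 * ((alpha ^ 2 * f u + beta ^ 2 * u * Derive f u) /
         (alpha ^ 2 * f u ^ 2 + beta ^ 2 * u ^ 2))
  + 2 * c * sqrt (1 - Derive f u ^ 2).

Definition ode2 (alpha beta c : R) (f : R -> R) (u : R) : Prop :=
  Derive (fun t => atan (Derive f t)) u =
  (alpha ^ 2 * f u + beta ^ 2 * u * Derive f u) /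
  (alpha ^ 2 * f u ^ 2 - beta ^ 2 * u ^ 2)
  + c * sqrt (1 + Derive f u ^ 2).

(* Up to parametrization, the curve [x] on [J] is [graph F], with [F] a
   solution of [ode]. *)
Definition determined_up_to_parametrization (J : R -> Prop) (x : R -> R41)
    (graph : (R -> R) -> R -> R41) (ode : (R -> R) -> R -> Prop) : Prop :=
  exists (J' : R -> Prop) (phi F : R -> R),
    is_interval J' /\ change_of_parameter J' J phi /\ smooth_on J' F /\
    (forall u, J' u -> x (phi u) = graph F u) /\
    (forall u, J' u -> ode F u).

Definition meridian1_determined (J : R -> Prop) (f g : R -> R) (alpha beta : R) : Prop :=
  exists c, c <> 0 /\
    determined_up_to_parametrization J (meridian1 f g)
      (fun F => meridian1 F (fun u => u)) (ode1 alpha beta c).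

Definition meridian2_determined (J : R -> Prop) (f g : R -> R) (alpha beta : R) : Prop :=
  exists c, c <> 0 /\
    determined_up_to_parametrization J (meridian2 f g)
      (fun F => meridian2 F (fun u => u)) (ode2 alpha beta c).

(* For the second type [Derive g] may vanish at some points, near which the
   meridian has no parametrization [(F u, 0, u, 0)].  Then the description
   applies to the pieces on which [Derive g <> 0], and these must be dense.
   Taking [g] as parameter reverses the orientation of the curve where
   [Derive g < 0], and this changes the sign of [c]; so [c] is the same on all
   pieces only up to sign. *)
Definition meridian2_piecewise_determined
    (J : R -> Prop) (f g : R -> R) (alpha beta : R) : Prop :=
  (forall a b, J a -> J b -> a < b -> exists u, a < u < b /\ Derive g u <> 0) /\
  exists c, c <> 0 /\
    forall I : R -> Prop,
      is_interval I -> (forall u, I u -> J u) -> (forall u, I u -> Derive g u <> 0) ->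
      exists c', (c' = c \/ c' = - c) /\
        determined_up_to_parametrization I (meridian2 f g)
          (fun F => meridian2 F (fun u => u)) (ode2 alpha beta c').

(* Main.v *)
Require Import Defs.
From Stdlib Require Import Reals Lra Ranalysis5 ClassicalEpsilon.
From Stdlib Require Import FunctionalExtensionality.
From Coquelicot Require Import Coquelicot.
Open Scope R_scope.

(** The curves [u = const] and [v = const] are orthogonal, and [z_u], [z_uu],
[z_vv] all lie in a plane orthogonal to [z_v]; hence [H] lies in that plane too
and is a multiple [h n] of the unit vector [n] of the plane normal to [z_u].
This gives [<H, H> = h ^ 2] as an expression in the meridian alone.  The two
types differ by a sign [e] ([-1] for the first, [1] for the second), and most of
the argument is carried out for both at once: the inner product of the plane is
[p * a + e * (q * b)], and [<H, H>] is [mean_curvature_sq]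
([mean_curvature_sq_rotational]).

Where [g'] does not vanish, [g] itself can serve as parameter
([parametrization_by_value]), the meridian becomes a graph [F], and [2 * h]
becomes, up to sign, [graph_curvature] ([mean_curvature_sq_graph]).  The
differential equations say exactly that [graph_curvature] is the constant [c]
([ode1_curvature], [ode2_curvature]), so they give [<H, H> = c ^ 2 / 4].
Conversely, if [<H, H>] is a non-zero constant then [graph_curvature] has a
constant non-zero square, and being continuous on an interval it is constant.
For the first type [g'] cannot vanish, as the meridian is timelike.

For the second type [g'] may vanish, but not on a whole interval: there [g]
would be constant, the constancy of [<H, H>] would make [f] constant as well, and
the meridian would not be regular
([dense_nonvanishing_derivative]).  The equivalence therefore holds on a dense
set of parameters, and it extends to all of them because [<H, H>] is
continuous.

The analytic care goes into the endpoints of the interval: derivatives are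
two-sided derivatives of smooth extensions, so one needs that they depend only
on the values on the interval ([Derive_eq_on_interval]), and that the inverse of
[g] is smooth on a neighbourhood. *)

(** * Closure properties of smooth functions *)

(** Recursion on the derivative, rather than on the iterated derivative as in
[ex_derive_n], makes the closure properties below follow by induction from the
rules of differentiation. *)
Fixpoint diff_times (n : nat) (U : R -> Prop) (f : R -> R) : Prop :=
  match n with
  | O => True
  | S m => (forall x, U x -> ex_derive f x) /\ diff_times m U (Derive f)
  end.

Lemma Derive_n_Derive (f : R -> R) (n : nat) (x : R) :
  Derive_n (Derive f) n x = Derive_n f (S n) x.
Proof.
rewrite <- Nat.add_1_r.
exact (Derive_n_comp f n 1 x).
Qed.

Lemma diff_times_ex_derive_n (U : R -> Prop) (f : R -> R) :
  (forall n, diff_times n U f) <-> (forall n x, U x -> ex_derive_n f n x).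
Proof.
split.
- intros Hf [|n] x Ux; [exact I|].
  generalize (Hf (S n)); clear Hf; revert f.
  induction n as [|n IH]; intros f [Hf Hf']; [now apply Hf|].
  apply (ex_derive_ext (Derive_n (Derive f) n)); [|exact (IH _ Hf')].
  intros t; apply Derive_n_Derive.
- intros Hf n; revert f Hf.
  induction n as [|n IH]; intros f Hf; [exact I|split].
  + intros x Ux; exact (Hf 1%nat x Ux).
  + apply IH; intros [|m] x Ux; [exact I|].
    apply (ex_derive_ext (Derive_n f (S m))); [|exact (Hf (S (S m)) x Ux)].
    intros t; symmetry; apply Derive_n_Derive.
Qed.

Lemma diff_times_S (n : nat) (U : R -> Prop) (f : R -> R) :
  diff_times (S n) U f -> diff_times n U f.
Proof.
revert f; induction n as [|n IH]; intros f [Hf Hf']; [exact I|split].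
- exact Hf.
- exact (IH _ Hf').
Qed.

Section Closure.

Variable U : R -> Prop.
Hypothesis openU : open U.

Lemma diff_times_ext (n : nat) (f g : R -> R) :
  (forall x, U x -> f x = g x) -> diff_times n U f -> diff_times n U g.
Proof.
revert f g; induction n as [|n IH]; intros f g Hfg Hf; [exact I|].
destruct Hf as [Hf Hf'].
assert (Hloc : forall x, U x -> locally x (fun t => f t = g t)).
{ now apply locally_open. }
split.
- intros x Ux; apply (ex_derive_ext_loc f); auto.
- apply (IH (Derive f)); [|exact Hf'].
  intros x Ux; apply Derive_ext_loc; auto.
Qed.

Lemma diff_times_const (n : nat) (a : R) : diff_times n U (fun _ => a).
Proof.
revert a; induction n as [|n IH]; intros a; [exact I|split].
- intros x _; apply ex_derive_const.
- apply (diff_times_ext n (fun _ => 0)); [|apply IH].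
  intros x _; symmetry; apply Derive_const.
Qed.

Lemma diff_times_plus (n : nat) (f g : R -> R) :
  diff_times n U f -> diff_times n U g -> diff_times n U (fun x => f x + g x).
Proof.
revert f g; induction n as [|n IH]; intros f g Hf Hg; [exact I|].
destruct Hf as [Hf Hf'], Hg as [Hg Hg']; split.
- intros x Ux; apply @ex_derive_plus; auto.
- apply (diff_times_ext n (fun x => Derive f x + Derive g x)); [|auto].
  intros x Ux; symmetry; apply Derive_plus; auto.
Qed.

Lemma diff_times_mult (n : nat) (f g : R -> R) :
  diff_times n U f -> diff_times n U g -> diff_times n U (fun x => f x * g x).
Proof.
revert f g; induction n as [|n IH]; intros f g Hf Hg; [exact I|].
assert (Hf0 := diff_times_S _ _ _ Hf); assert (Hg0 := diff_times_S _ _ _ Hg).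
destruct Hf as [Hf Hf'], Hg as [Hg Hg']; split.
- intros x Ux; apply ex_derive_mult; auto.
- apply (diff_times_ext n (fun x => Derive f x * g x + f x * Derive g x)).
  + intros x Ux; symmetry; apply Derive_mult; auto.
  + apply diff_times_plus; auto.
Qed.

Lemma diff_times_inv (n : nat) (f : R -> R) :
  (forall x, U x -> f x <> 0) -> diff_times n U f ->
  diff_times n U (fun x => / f x).
Proof.
intros f0; induction n as [|n IH]; intros Hf; [exact I|].
assert (IHf := IH (diff_times_S _ _ _ Hf)).
destruct Hf as [Hf Hf']; split.
- intros x Ux; apply ex_derive_inv; auto.
- apply (diff_times_ext n (fun x => (-1) * (Derive f x * (/ f x * / f x)))).
  + intros x Ux; rewrite Derive_inv; auto; field; auto.
  + apply diff_times_mult; [apply diff_times_const|].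
    apply diff_times_mult; [exact Hf'|].
    now apply diff_times_mult.
Qed.

Lemma diff_times_comp (V : R -> Prop) (n : nat) (f phi : R -> R) :
  (forall x, U x -> V (phi x)) ->
  diff_times n V f -> diff_times n U phi -> diff_times n U (fun x => f (phi x)).
Proof.
intros UV; revert f; induction n as [|n IH]; intros f Hf Hphi; [exact I|].
assert (Hphi0 := diff_times_S _ _ _ Hphi).
destruct Hf as [Hf Hf'], Hphi as [Hphi Hphi']; split.
- intros x Ux; apply @ex_derive_comp; auto.
- apply (diff_times_ext n (fun x => Derive phi x * Derive f (phi x))).
  + intros x Ux; symmetry; apply Derive_comp; auto.
  + apply diff_times_mult; [exact Hphi'|now apply IH].
Qed.

End Closure.

Lemma smooth_on_diff_times (J : R -> Prop) (f : R -> R) :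
  smooth_on J f <->
  exists U : R -> Prop,
    open U /\ (forall x, J x -> U x) /\ (forall n, diff_times n U f).
Proof.
split; intros (U & oU & JU & Hf); exists U; repeat split; try assumption;
  now apply diff_times_ex_derive_n.
Qed.

Lemma smooth_on_subset (I J : R -> Prop) (f : R -> R) :
  (forall x, I x -> J x) -> smooth_on J f -> smooth_on I f.
Proof.
intros IJ (U & oU & JU & Hf); exists U; repeat split; auto.
Qed.

Lemma smooth_on_Derive (J : R -> Prop) (f : R -> R) :
  smooth_on J f -> smooth_on J (Derive f).
Proof.
rewrite !smooth_on_diff_times; intros (U & oU & JU & Hf).
exists U; repeat split; auto.
intros n; exact (proj2 (Hf (S n))).
Qed.

Lemma smooth_on_ex_derive (J : R -> Prop) (f : R -> R) (x : R) :
  smooth_on J f -> J x -> ex_derive f x.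
Proof.
intros (U & oU & JU & Hf) Jx; exact (Hf 1%nat x (JU x Jx)).
Qed.

Lemma smooth_on_ex_derive_3 (J : R -> Prop) (f : R -> R) (x : R) :
  smooth_on J f -> J x ->
  ex_derive f x /\ ex_derive (Derive f) x /\ ex_derive (Derive (Derive f)) x.
Proof.
intros hf Jx.
assert (hf' := smooth_on_Derive J f hf).
assert (hf'' := smooth_on_Derive J _ hf').
now repeat split; apply (smooth_on_ex_derive J).
Qed.

Lemma ex_derive_continuity_pt (f : R -> R) (x : R) :
  ex_derive f x -> continuity_pt f x.
Proof.
intros Hf; apply continuity_pt_filterlim; exact (ex_derive_continuous f x Hf).
Qed.

Lemma smooth_on_comp (J' J : R -> Prop) (f phi : R -> R) :
  smooth_on J' phi -> (forall u, J' u -> J (phi u)) -> smooth_on J f ->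
  smooth_on J' (fun u => f (phi u)).
Proof.
rewrite !smooth_on_diff_times.
intros (U & oU & JU & Hphi) JJ (V & oV & JV & Hf).
(* [phi] maps [J'] into [V], but need not do so on all of [U]. *)
set (W := fun x => U x /\ V (phi x)).
assert (oW : open W).
{ intros x [Ux Vx]; apply filter_and; [now apply oU|].
  apply (ex_derive_continuous phi x (proj1 (Hphi 1%nat) x Ux)).
  now apply oV. }
exists W; split; [exact oW|split].
- intros x Jx; split; auto.
- intros n; apply (diff_times_comp W oW V); [now intros x []|apply Hf|].
  assert (HW : forall m p, diff_times m U p -> diff_times m W p).
  { induction m as [|m IH]; intros p Hp; [exact I|].
    destruct Hp as [Hp Hp']; split; [|auto].
    intros x [Ux _]; auto. }
  auto.
Qed.

(** * Functions on an interval *)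

Lemma interval_near (J : R -> Prop) (x d : R) :
  is_interval J -> J x -> 0 < d -> exists y, J y /\ y <> x /\ Rabs (y - x) < d.
Proof.
intros [(a & b & ab & Ja & Jb) convJ] Jx Hd.
destruct (Rlt_le_dec x b) as [xb|bx].
- exists (Rmin b (x + d / 2)); repeat split.
  + apply (convJ x b); auto; unfold Rmin; destruct Rle_dec; lra.
  + unfold Rmin; destruct Rle_dec; lra.
  + apply Rabs_def1; unfold Rmin; destruct Rle_dec; lra.
- exists (Rmax a (x - d / 2)); repeat split.
  + apply (convJ a x); auto; unfold Rmax; destruct Rle_dec; lra.
  + unfold Rmax; destruct Rle_dec; lra.
  + apply Rabs_def1; unfold Rmax; destruct Rle_dec; lra.
Qed.

(** Every point of [J], endpoints included, is a limit of other points of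
[J], so difference quotients inside [J] determine the derivative. *)
Lemma Derive_eq_on_interval (J : R -> Prop) (f g : R -> R) (x : R) :
  is_interval J -> J x -> (forall t, J t -> f t = g t) ->
  ex_derive f x -> ex_derive g x -> Derive f x = Derive g x.
Proof.
intros hJ Jx fg Hf Hg.
assert (Hd : is_derive (fun t => f t - g t) x (Derive f x - Derive g x)).
{ apply @is_derive_minus; now apply Derive_correct. }
apply is_derive_Reals in Hd.
destruct (Req_dec (Derive f x) (Derive g x)) as [E|NE]; [exact E|exfalso].
assert (Hpos : 0 < Rabs (Derive f x - Derive g x)).
{ apply Rabs_pos_lt; lra. }
destruct (Hd _ Hpos) as [[d dpos] Hq]; simpl in Hq.
destruct (interval_near J x d hJ Jx dpos) as (y & Jy & yx & yd).
specialize (Hq (y - x) ltac:(lra) yd).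
replace (x + (y - x)) with y in Hq by ring.
rewrite (fg y Jy), (fg x Jx) in Hq.
replace ((g y - g y - (g x - g x)) / (y - x) - (Derive f x - Derive g x))
  with (- (Derive f x - Derive g x)) in Hq by (field; lra).
rewrite Rabs_Ropp in Hq; lra.
Qed.

Lemma nonvanishing_same_sign (J : R -> Prop) (q : R -> R) :
  (forall a b x, J a -> J b -> a <= x <= b -> J x) ->
  (forall x, J x -> continuity_pt q x) -> (forall x, J x -> q x <> 0) ->
  forall x y, J x -> J y -> 0 < q x * q y.
Proof.
intros convJ cq q0.
(* The intermediate value theorem for [t |-> q x * q t], which starts at a
   positive value. *)
assert (Hlt : forall x y, J x -> J y -> x < y -> 0 < q x * q y).
{ intros x y Jx Jy xy.
  destruct (Rlt_le_dec 0 (q x * q y)) as [H|H]; [exact H|exfalso].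
  assert (qx := q0 x Jx); assert (qy := q0 y Jy).
  assert (H0 : q x * q y <> 0) by (apply Rmult_integral_contrapositive; auto).
  destruct (IVT_interv (fun t => (- q x) * q t) x y) as (z & Hz & Ez).
  - intros t Ht; apply continuity_pt_scal, cq, (convJ x y); auto.
  - exact xy.
  - nra.
  - nra.
  - apply (q0 z (convJ x y z Jx Jy Hz)); nra. }
intros x y Jx Jy; destruct (Rtotal_order x y) as [H|[<-|H]].
- auto.
- assert (qx := q0 x Jx); nra.
- rewrite Rmult_comm; auto.
Qed.

(** A continuous square root of [k] cannot jump from [c] to [- c] without
passing through [0]. *)
Lemma constant_of_constant_square (J : R -> Prop) (q : R -> R) (k : R) :
  is_interval J -> (forall x, J x -> continuity_pt q x) ->
  k <> 0 -> (forall x, J x -> q x ^ 2 = k) ->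
  exists c, c ^ 2 = k /\ forall x, J x -> q x = c.
Proof.
intros [(a & b & ab & Ja & Jb) convJ] cq k0 qk.
exists (q a); split; [auto|intros x Jx].
assert (q0 : forall t, J t -> q t <> 0).
{ intros t Jt E; apply k0; rewrite <- (qk t Jt), E; ring. }
assert (H := nonvanishing_same_sign J q convJ cq q0 x a Jx Ja).
assert (Ex := qk x Jx); assert (Ea := qk a Ja).
assert (E : (q x - q a) * (q x + q a) = 0) by nra.
apply Rmult_integral in E; nra.
Qed.

(** * Smooth inverses of strictly monotone functions *)

(** The derivative keeps its sign on the interval [V], say that of [Derive g
x0], and the mean value theorem makes [g] strictly monotone in that
direction. *)
Lemma strictly_monotone (V : R -> Prop) (g : R -> R) :
  (forall a b x, V a -> V b -> a <= x <= b -> V x) ->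
  (forall x, V x -> ex_derive g x) ->
  (forall x, V x -> continuity_pt (Derive g) x) ->
  (forall x, V x -> Derive g x <> 0) ->
  forall x0 x y, V x0 -> V x -> V y -> x < y ->
  0 < Derive g x0 * (g y - g x).
Proof.
intros convV dg cg g0 x0 x y V0 Vx Vy xy.
destruct (MVT_gen g x y (Derive g)) as (c & Hc & E).
- rewrite Rmin_left, Rmax_right by lra; intros t Ht.
  apply Derive_correct, dg, (convV x y); auto; lra.
- rewrite Rmin_left, Rmax_right by lra; intros t Ht.
  apply ex_derive_continuity_pt, dg, (convV x y); auto; lra.
- rewrite Rmin_left, Rmax_right in Hc by lra.
  assert (Vc : V c) by (apply (convV x y); auto).
  assert (H := nonvanishing_same_sign V (Derive g) convV cg g0 x0 c V0 Vc).
  rewrite E; nra.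
Qed.

(** The values of [g] on [V] form an open set, on which the inverse is unique by
monotonicity; its smoothness propagates from [(g^-1)' = 1 / (g' o g^-1)]. *)
Lemma smooth_inverse (V : R -> Prop) (g : R -> R) :
  open V -> (forall a b x, V a -> V b -> a <= x <= b -> V x) ->
  (forall n, diff_times n V g) -> (forall x, V x -> Derive g x <> 0) ->
  exists phi : R -> R,
    open (fun y => exists x, V x /\ g x = y) /\
    (forall n, diff_times n (fun y => exists x, V x /\ g x = y) phi) /\
    (forall x, V x -> phi (g x) = x).
Proof.
intros oV convV gV g0.
assert (dg : forall x, V x -> ex_derive g x) by exact (proj1 (gV 1%nat)).
assert (cdg : forall x, V x -> continuity_pt (Derive g) x).
{ intros x Vx; apply ex_derive_continuity_pt.
  exact (proj1 (proj2 (gV 2%nat)) x Vx). }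
assert (mono := strictly_monotone V g convV dg cdg g0).
assert (inj : forall x y, V x -> V y -> g x = g y -> x = y).
{ intros x y Vx Vy E; destruct (Rtotal_order x y) as [H|[H|H]]; [|exact H|].
  - assert (M := mono x x y Vx Vx Vy H); rewrite E in M; lra.
  - assert (M := mono x y x Vx Vy Vx H); rewrite E in M; lra. }
set (W := fun y => exists x, V x /\ g x = y).
(* The intermediate value theorem makes [g] open; this gives at once that [W]
   is open and that the inverse is continuous. *)
assert (opn : forall x0 eps, V x0 -> 0 < eps ->
  locally (g x0) (fun y => exists x, V x /\ g x = y /\ Rabs (x - x0) < eps)).
{ intros x0 eps V0 Heps.
  destruct (oV x0 V0) as [[d dpos] Hd]; simpl in Hd.
  set (r := Rmin eps d / 2).
  assert (Hr : 0 < r < eps /\ r < d).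
  { unfold r, Rmin; destruct Rle_dec; lra. }
  assert (Vr : forall t, x0 - r <= t <= x0 + r -> V t).
  { intros t Ht; apply Hd.
    unfold ball; simpl; unfold AbsRing_ball, abs, minus, plus, opp; simpl.
    apply Rabs_def1; lra. }
  assert (Va := Vr (x0 - r) ltac:(lra)); assert (Vb := Vr (x0 + r) ltac:(lra)).
  assert (Ma := mono x0 (x0 - r) x0 V0 Va V0 ltac:(lra)).
  assert (Mb := mono x0 x0 (x0 + r) V0 V0 Vb ltac:(lra)).
  set (s := Derive g x0) in *.
  assert (spos : 0 < Rabs s) by (apply Rabs_pos_lt, g0, V0).
  assert (rho : 0 < Rmin (s * (g x0 - g (x0 - r))) (s * (g (x0 + r) - g x0))
                    / Rabs s).
  { apply Rdiv_lt_0_compat; [|exact spos].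
    unfold Rmin; destruct Rle_dec; lra. }
  exists (mkposreal _ rho); intros y Hy.
  unfold ball in Hy; simpl in Hy.
  unfold AbsRing_ball, abs, minus, plus, opp in Hy; simpl in Hy.
  apply (Rmult_lt_compat_r (Rabs s) _ _ spos) in Hy.
  rewrite <- Rabs_mult in Hy; unfold Rdiv in Hy.
  rewrite Rmult_assoc, Rinv_l, Rmult_1_r in Hy by lra.
  apply Rabs_def2 in Hy.
  assert (Hmin1 := Rmin_l (s * (g x0 - g (x0 - r))) (s * (g (x0 + r) - g x0))).
  assert (Hmin2 := Rmin_r (s * (g x0 - g (x0 - r))) (s * (g (x0 + r) - g x0))).
  destruct (IVT_interv (fun t => s * (g t - y)) (x0 - r) (x0 + r))
    as (x & Hx & Ex).
  - intros t Ht; apply continuity_pt_scal, continuity_pt_minus.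
    + apply ex_derive_continuity_pt; auto.
    + now apply continuity_pt_const; intros ? ?.
  - lra.
  - lra.
  - lra.
  - exists x; split; [auto|split].
    + apply Rmult_integral in Ex; destruct Ex as [Ex|Ex]; [|lra].
      exfalso; rewrite Ex, Rabs_R0 in spos; lra.
    + apply Rabs_def1; lra. }
assert (oW : open W).
{ intros y (x & Vx & <-).
  destruct (opn x 1 Vx Rlt_0_1) as [d Hd]; exists d; intros y Hy.
  destruct (Hd y Hy) as (t & Vt & E & _); now exists t. }
set (phi := fun y => epsilon (inhabits 0) (fun x => V x /\ g x = y)).
assert (Vphi : forall y, W y -> V (phi y) /\ g (phi y) = y).
{ intros y Wy; exact (epsilon_spec (inhabits 0) _ Wy). }
assert (phig : forall x, V x -> phi (g x) = x).
{ intros x Vx; destruct (Vphi (g x)) as [H1 H2]; [now exists x|auto]. }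
assert (dphi : forall y, W y -> is_derive phi y (/ Derive g (phi y))).
{ intros y (x0 & V0 & <-); rewrite phig by exact V0.
  apply is_derive_Reals; intros eps Heps.
  (* The difference quotient of the inverse at [g x0] is the inverse of a
     difference quotient of [g] at [x0]. *)
  assert (Hq : is_lim (fun k => / ((g (x0 + k) - g x0) / k)) 0
                      (/ Derive g x0)).
  { apply (is_lim_inv _ 0 (Derive g x0)).
    - apply is_lim_Reals_1; intros e He.
      destruct (proj1 (is_derive_Reals g x0 (Derive g x0))
                  (Derive_correct g x0 (dg x0 V0)) e He) as [[d dpos] Hd].
      exists d; split; [exact dpos|].
      intros k [k0 Hk]; simpl in *; unfold Rdist in *.
      rewrite Rminus_0_r in Hk; auto.
    - intros E; injection E; exact (g0 x0 V0). }
  apply is_lim_spec in Hq; destruct (Hq (mkposreal eps Heps)) as [[d1 Hd1] Hk].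
  simpl in Hk.
  destruct (opn x0 d1 V0 Hd1) as [d Hd]; exists d; intros h h0 Hh.
  destruct (Hd (g x0 + h)) as (x & Vx & E & Hx).
  { unfold ball; simpl; unfold AbsRing_ball, abs, minus, plus, opp; simpl.
    replace (g x0 + h + - g x0) with h by ring; exact Hh. }
  rewrite <- E, !phig by assumption.
  assert (xx0 : x <> x0).
  { intros ->; apply h0; lra. }
  specialize (Hk (x - x0)).
  replace (x0 + (x - x0)) with x in Hk by ring.
  replace (g x - g x0) with h in Hk by lra.
  replace (/ (h / (x - x0))) with ((x - x0) / h) in Hk by (field; lra).
  apply Hk; [|lra].
  unfold ball; simpl; unfold AbsRing_ball, abs, minus, plus, opp; simpl.
  replace (x - x0 + - 0) with (x - x0) by ring; exact Hx. }
exists phi; split; [exact oW|split; [|exact phig]].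
(* The derivative [/ Derive g (phi y)] of the inverse is as often
   differentiable as [phi] itself, which drives the induction. *)
induction n as [|n IH]; [exact I|split].
- intros y Wy; eexists; exact (dphi y Wy).
- apply (diff_times_ext W oW n (fun y => / Derive g (phi y))).
  + intros y Wy; symmetry; exact (is_derive_unique _ _ _ (dphi y Wy)).
  + apply (diff_times_inv W oW n (fun y => Derive g (phi y))).
    * intros y Wy; apply g0, Vphi, Wy.
    * apply (diff_times_comp W oW V); [now intros y Wy; apply Vphi| |exact IH].
      exact (proj2 (gV (S n))).
Qed.

(** Smoothness on [J] lives on an open neighbourhood, on which [g] need not be
monotone.  The inverse is taken on the
points joined to [J] by a segment on which [Derive g] does not vanish: this is
an open interval, hence [g] is monotone on it. *)
Lemma parametrization_by_value (J : R -> Prop) (g : R -> R) :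
  is_interval J -> smooth_on J g -> (forall u, J u -> Derive g u <> 0) ->
  exists (J' : R -> Prop) (phi : R -> R),
    is_interval J' /\ change_of_parameter J' J phi /\
    (forall u, J' u -> g (phi u) = u).
Proof.
intros hJ hg g0; assert (hg' := hg).
apply smooth_on_diff_times in hg'; destruct hg' as (U & oU & JU & gU).
destruct hJ as [(a & b & ab & Ja & Jb) convJ].
set (V := fun x => U x /\ Derive g x <> 0).
assert (oV : open V).
{ intros x [Ux x0]; apply filter_and; [now apply oU|].
  exact (ex_derive_continuous (Derive g) x (proj1 (proj2 (gU 2%nat)) x Ux)
           _ (open_neq 0 _ x0)). }
set (V0 := fun x => exists j, J j /\
  forall y, Rmin j x <= y <= Rmax j x -> V y).
assert (JV0 : forall x, J x -> V0 x).
{ intros x Jx; exists x; split; [exact Jx|].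
  intros y; rewrite Rmin_left, Rmax_left by lra; intros Hy.
  replace y with x by lra; split; auto. }
assert (V0V : forall x, V0 x -> V x).
{ intros x (j & _ & H); apply H; split; [apply Rmin_r|apply Rmax_r]. }
assert (oV0 : open V0).
{ intros x (j & Jj & H).
  destruct (oV x) as [d Hd].
  { apply H; split; [apply Rmin_r|apply Rmax_r]. }
  exists d; intros x' Hx'; exists j; split; [exact Jj|intros y Hy].
  destruct (Rle_dec (Rmin j x) y) as [H1|H1];
    [destruct (Rle_dec y (Rmax j x)) as [H2|H2]; [now apply H|]|];
    apply Hd; revert Hx'; unfold ball; simpl;
    unfold AbsRing_ball, abs, minus, plus, opp; simpl;
    intros Hx'; apply Rabs_def2 in Hx'; apply Rabs_def1;
    revert Hy H1; try (revert H2); unfold Rmin, Rmax;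
    repeat destruct Rle_dec; lra. }
assert (convV0 : forall p q x, V0 p -> V0 q -> p <= x <= q -> V0 x).
{ intros p q x (j & Jj & Hj) (l & Jl & Hl) Hx.
  destruct (Rle_dec x j) as [xj|jx].
  - exists j; split; [exact Jj|intros y Hy; apply Hj].
    revert Hy; unfold Rmin, Rmax; repeat destruct Rle_dec; lra.
  - destruct (Rle_dec x l) as [xl|lx].
    + apply JV0, (convJ j l); auto; lra.
    + exists l; split; [exact Jl|intros y Hy; apply Hl].
      revert Hy; unfold Rmin, Rmax; repeat destruct Rle_dec; lra. }
assert (gV0 : forall n, diff_times n V0 g).
{ assert (HW : forall m p, diff_times m U p -> diff_times m V0 p).
  { induction m as [|m IH]; intros p Hp; [exact I|].
    destruct Hp as [Hp Hp']; split; [|auto].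
    intros x Vx; apply Hp, (V0V x Vx). }
  auto. }
destruct (smooth_inverse V0 g oV0 convV0 gV0) as (phi & oW & dphi & phig).
{ intros x Vx; apply (V0V x Vx). }
assert (inj : forall x y, J x -> J y -> g x = g y -> x = y).
{ intros x y Jx Jy E; rewrite <- (phig x), <- (phig y); auto; now rewrite E. }
exists (fun y => exists x, J x /\ g x = y), phi.
split; [split|split; [split; [|split; [|split]]|]].
- assert (gab : g a <> g b) by (intros E; apply inj in E; auto; lra).
  destruct (Rlt_le_dec (g a) (g b)) as [H|H].
  + exists (g a), (g b); repeat split; [exact H|now exists a|now exists b].
  + exists (g b), (g a); repeat split; [lra|now exists b|now exists a].
- intros p q y (x1 & J1 & <-) (x2 & J2 & <-) Hy.
  destruct (Req_dec (g x1) y) as [E1|N1]; [now exists x1|].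
  destruct (Req_dec (g x2) y) as [E2|N2]; [now exists x2|].
  assert (cg : forall t, J t -> continuity_pt g t).
  { intros t Jt; now apply ex_derive_continuity_pt, (smooth_on_ex_derive J). }
  destruct (Rtotal_order x1 x2) as [H|[H|H]].
  + destruct (IVT_interv (fun t => g t - y) x1 x2) as (x & Hx & Ex);
      [|exact H|lra|lra|].
    * intros t Ht; apply continuity_pt_minus.
      -- apply cg, (convJ x1 x2); auto.
      -- now apply continuity_pt_const; intros ? ?.
    * exists x; split; [apply (convJ x1 x2); auto|lra].
  + rewrite H in N1, Hy; lra.
  + destruct (IVT_interv (fun t => y - g t) x2 x1) as (x & Hx & Ex);
      [|exact H|lra|lra|].
    * intros t Ht; apply continuity_pt_minus.
      -- now apply continuity_pt_const; intros ? ?.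
      -- apply cg, (convJ x2 x1); auto.
    * exists x; split; [apply (convJ x2 x1); auto|lra].
- apply smooth_on_diff_times.
  exists (fun y => exists x, V0 x /\ g x = y); repeat split; auto.
  intros y (x & Jx & E); exists x; auto.
- (* Differentiating [phi (g t) = t] shows that [Derive phi] has no zero. *)
  intros y (x & Jx & <-) E.
  assert (Hd : ex_derive phi (g x)).
  { apply (proj1 (dphi 1%nat)); exists x; auto. }
  assert (H : Derive (fun t => phi (g t)) x = 1).
  { rewrite (Derive_ext_loc _ (fun t => t)); [apply Derive_id|].
    generalize (oV0 x (JV0 x Jx)); apply filter_imp; exact phig. }
  rewrite Derive_comp in H.
  + rewrite E in H; lra.
  + exact Hd.
  + now apply (smooth_on_ex_derive J).
- intros y (x & Jx & <-); rewrite phig; auto.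
- intros x Jx; exists (g x); split; [now exists x|auto].
- intros y (x & Jx & <-); rewrite phig; auto.
Qed.

(** * The mean curvature of a general rotational surface *)

(** The sign [e] is [-1] for the first type and [1] for the second one; the
metric of the meridian plane is [dp ^ 2 + e * dq ^ 2], so that [<z_u, z_u>] is
[e * speed_sq], and [speed_sq] is positive on a timelike surface of either
type. *)
Definition speed_sq (e : R) (f g : R -> R) (u : R) : R :=
  Derive g u ^ 2 + e * Derive f u ^ 2.

(** This is [<z_v, z_v>]: positive for the first type, negative for the second
one. *)
Definition rotation_sq (e alpha beta : R) (f g : R -> R) (u : R) : R :=
  alpha ^ 2 * f u ^ 2 - e * beta ^ 2 * g u ^ 2.

(** This is [<H, H>] as a function of the meridian, see
[mean_curvature_sq_rotational].  Up to a common factor, the first summand is the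
curvature of the meridian in its plane, and the second one the normal curvature
of the orbits of the rotation. *)
Definition mean_curvature_sq (e alpha beta : R) (f g : R -> R) (u : R) : R :=
  ((Derive (Derive f) u * Derive g u - Derive (Derive g) u * Derive f u)
     / speed_sq e f g u
   - e * ((alpha ^ 2 * f u * Derive g u + beta ^ 2 * g u * Derive f u)
          / rotation_sq e alpha beta f g u)) ^ 2
  / (4 * speed_sq e f g u).

Lemma R41_eq (a1 a2 a3 a4 b1 b2 b3 b4 : R) :
  a1 = b1 -> a2 = b2 -> a3 = b3 -> a4 = b4 ->
  (a1, a2, a3, a4) = (b1, b2, b3, b4) :> R41.
Proof. now intros -> -> -> ->. Qed.

Lemma scal_R41 (k a1 a2 a3 a4 : R) :
  scal k ((a1, a2, a3, a4) : R41) = (k * a1, k * a2, k * a3, k * a4).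
Proof. reflexivity. Qed.

Lemma plus_R41 (a1 a2 a3 a4 b1 b2 b3 b4 : R) :
  plus ((a1, a2, a3, a4) : R41) (b1, b2, b3, b4) =
  (a1 + b1, a2 + b2, a3 + b3, a4 + b4).
Proof. reflexivity. Qed.

Lemma minus_R41 (a1 a2 a3 a4 b1 b2 b3 b4 : R) :
  minus ((a1, a2, a3, a4) : R41) (b1, b2, b3, b4) =
  (a1 - b1, a2 - b2, a3 - b3, a4 - b4).
Proof. reflexivity. Qed.

(** For orthogonal parameters [H] is half the normal part of [w], and the
square of a normal part is given by Pythagoras' theorem. *)
Lemma mean_curvature_sq_orthogonal (z : surface) (u v : R) :
  gF z u v = 0 -> gE z u v <> 0 -> gG z u v <> 0 ->
  let w := plus (scal (/ gE z u v) (du (du z) u v))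
                (scal (/ gG z u v) (dv (dv z) u v)) in
  mink (mean_curvature_vector z u v) (mean_curvature_vector z u v) =
  / 4 * (mink w w - mink w (du z u v) ^ 2 / gE z u v
                  - mink w (dv z u v) ^ 2 / gG z u v).
Proof.
intros HF HE HG w.
assert (Hd : gdet z u v <> 0).
{ unfold gdet; rewrite HF.
  replace (gE z u v * gG z u v - 0 ^ 2) with (gE z u v * gG z u v) by ring.
  now apply Rmult_integral_contrapositive. }
assert (HH : mean_curvature_vector z u v = scal (/ 2) (normal_part z u v w)).
{ unfold mean_curvature_vector, second_ff, normal_part, tangent_part, w.
  rewrite !mink_plus_l, !mink_scal_l.
  assert (Ed : gdet z u v = gE z u v * gG z u v) by (unfold gdet; rewrite HF; ring).
  rewrite Ed, HF.
  destruct (du (du z) u v) as [[[a1 a2] a3] a4].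
  destruct (dv (du z) u v) as [[[b1 b2] b3] b4].
  destruct (dv (dv z) u v) as [[[c1 c2] c3] c4].
  destruct (du z u v) as [[[d1 d2] d3] d4].
  destruct (dv z u v) as [[[e1 e2] e3] e4].
  cbn [fst snd].
  repeat (rewrite scal_R41 || rewrite plus_R41 || rewrite minus_R41).
  apply R41_eq; field; auto. }
destruct (normal_part_orthogonal z u v w Hd) as [H1 H2].
rewrite HH, mink_scal_l, mink_sym, mink_scal_l.
assert (Hn : mink (normal_part z u v w) (normal_part z u v w) =
             mink w (normal_part z u v w)).
{ unfold normal_part at 1; rewrite mink_minus_l.
  unfold tangent_part; rewrite mink_plus_l, !mink_scal_l.
  rewrite (mink_sym (du z u v)), (mink_sym (dv z u v)), H1, H2; ring. }
rewrite Hn, mink_sym; unfold normal_part, tangent_part.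
rewrite mink_minus_l, mink_plus_l, !mink_scal_l.
rewrite (mink_sym (du z u v) w), (mink_sym (dv z u v) w).
unfold gdet; rewrite HF; field; auto.
Qed.

(** With [z_u], [z_uu], [z_vv] in the plane [T], which is orthogonal to [z_v],
the computation of [<H, H>] takes place in that plane, where the normal
component of [T p q] with respect to [T a b] has square
[e * (p * b - q * a) ^ 2 / (a ^ 2 + e * b ^ 2)]. *)
Lemma mean_curvature_sq_rotational (z : surface) (T : R -> R -> R41)
    (e alpha beta : R) (f g : R -> R) (u v : R) :
  e ^ 2 = 1 ->
  (forall p q a b, mink (T p q) (T a b) = p * a + e * (q * b)) ->
  (forall p q, mink (T p q) (dv z u v) = 0) ->
  du z u v = T (Derive f u) (Derive g u) ->
  du (du z) u v = T (Derive (Derive f) u) (Derive (Derive g) u) ->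
  dv (dv z) u v = T (- alpha ^ 2 * f u) (beta ^ 2 * g u) ->
  gG z u v = rotation_sq e alpha beta f g u ->
  0 < speed_sq e f g u -> rotation_sq e alpha beta f g u <> 0 ->
  mink (mean_curvature_vector z u v) (mean_curvature_vector z u v) =
  mean_curvature_sq e alpha beta f g u.
Proof.
intros He HT HTv Hu Huu Hvv HG Hs Hr.
assert (HE : gE z u v = e * speed_sq e f g u).
{ unfold gE, speed_sq; rewrite Hu, HT.
  replace (Derive f u * Derive f u) with (e ^ 2 * Derive f u ^ 2)
    by (rewrite He; ring).
  ring. }
assert (e0 : e <> 0) by nra.
rewrite mean_curvature_sq_orthogonal; cbv zeta.
- rewrite Huu, Hvv, Hu, HE, HG.
  rewrite !mink_plus_l, !mink_scal_l, !HTv.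
  rewrite (mink_sym (T (Derive (Derive f) u) _) (plus _ _)).
  rewrite (mink_sym (T (- alpha ^ 2 * f u) _) (plus _ _)).
  rewrite !mink_plus_l, !mink_scal_l, !HT.
  unfold mean_curvature_sq.
  set (r := rotation_sq e alpha beta f g u) in *.
  unfold speed_sq in *.
  assert (He' : e = 1 \/ e = -1).
  { assert (H : (e - 1) * (e + 1) = 0) by nra.
    apply Rmult_integral in H; lra. }
  destruct He' as [-> | ->]; field; repeat split; lra.
- unfold gF; rewrite Hu; apply HTv.
- rewrite HE; apply Rmult_integral_contrapositive; split; lra.
- now rewrite HG.
Qed.

Lemma cosh_sq_sinh_sq (t : R) : cosh t * cosh t = 1 + sinh t * sinh t.
Proof.
unfold cosh, sinh.
assert (E : exp t * exp (- t) = 1).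
{ rewrite <- exp_plus, Rplus_opp_r; apply exp_0. }
nra.
Qed.

Lemma cos_sq_sin_sq (t : R) : cos t * cos t = 1 - sin t * sin t.
Proof. exact (cos2 t). Qed.

Lemma du_M1 (f g : R -> R) (alpha beta : R) :
  du (M1 f g alpha beta) = M1 (Derive f) (Derive g) alpha beta.
Proof.
apply functional_extensionality; intros u.
apply functional_extensionality; intros v.
unfold du, Derive4, M1; simpl; now rewrite !Derive_scal_l.
Qed.

Lemma du_M2 (f g : R -> R) (alpha beta : R) :
  du (M2 f g alpha beta) = M2 (Derive f) (Derive g) alpha beta.
Proof.
apply functional_extensionality; intros u.
apply functional_extensionality; intros v.
unfold du, Derive4, M2; simpl; now rewrite !Derive_scal_l.
Qed.

Lemma Derive_circular (r omega v : R) :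
  Derive (fun s => r * cos (omega * s)) v = - omega * r * sin (omega * v) /\
  Derive (fun s => r * sin (omega * s)) v = omega * r * cos (omega * v).
Proof. split; apply is_derive_unique; auto_derive; trivial; ring. Qed.

Lemma Derive_hyperbolic (r omega v : R) :
  Derive (fun s => r * cosh (omega * s)) v = omega * r * sinh (omega * v) /\
  Derive (fun s => r * sinh (omega * s)) v = omega * r * cosh (omega * v).
Proof.
unfold cosh, sinh; split; apply is_derive_unique; auto_derive; trivial; field.
Qed.

Lemma dv_M1 (f g : R -> R) (alpha beta : R) :
  dv (M1 f g alpha beta) =
  fun u v => (- alpha * f u * sin (alpha * v), alpha * f u * cos (alpha * v),
              beta * g u * cosh (beta * v), beta * g u * sinh (beta * v)).
Proof.
apply functional_extensionality; intros u.
apply functional_extensionality; intros v.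
unfold dv, Derive4, M1; simpl.
destruct (Derive_circular (f u) alpha v) as [-> ->].
now destruct (Derive_hyperbolic (g u) beta v) as [-> ->].
Qed.

Lemma dv_M2 (f g : R -> R) (alpha beta : R) :
  dv (M2 f g alpha beta) =
  fun u v => (- alpha * f u * sin (alpha * v), alpha * f u * cos (alpha * v),
              beta * g u * sinh (beta * v), beta * g u * cosh (beta * v)).
Proof.
apply functional_extensionality; intros u.
apply functional_extensionality; intros v.
unfold dv, Derive4, M2; simpl.
destruct (Derive_circular (f u) alpha v) as [-> ->].
now destruct (Derive_hyperbolic (g u) beta v) as [-> ->].
Qed.

Lemma mean_curvature_sq_M1 (f g : R -> R) (alpha beta u v : R) :
  0 < speed_sq (-1) f g u -> rotation_sq (-1) alpha beta f g u <> 0 ->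
  let H := mean_curvature_vector (M1 f g alpha beta) u v in
  mink H H = mean_curvature_sq (-1) alpha beta f g u.
Proof.
intros Hs Hr H; unfold H; clear H.
assert (Hc := cos_sq_sin_sq (alpha * v)).
assert (Hh := cosh_sq_sinh_sq (beta * v)).
apply (mean_curvature_sq_rotational _
  (fun p q => M1 (fun _ => p) (fun _ => q) alpha beta u v)); trivial.
- ring.
- intros p q a b; unfold M1, mink; ring [Hc Hh].
- intros p q; rewrite dv_M1; unfold M1, mink; ring.
- now rewrite du_M1.
- now rewrite !du_M1.
- rewrite dv_M1; unfold dv, Derive4, M1; simpl.
  destruct (Derive_circular (- alpha * f u) alpha v) as [_ ->].
  destruct (Derive_circular (alpha * f u) alpha v) as [-> _].
  destruct (Derive_hyperbolic (beta * g u) beta v) as [-> ->].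
  apply R41_eq; ring.
- unfold gG, rotation_sq; rewrite dv_M1; unfold mink; ring [Hc Hh].
Qed.

Lemma mean_curvature_sq_M2 (f g : R -> R) (alpha beta u v : R) :
  0 < speed_sq 1 f g u -> rotation_sq 1 alpha beta f g u <> 0 ->
  let H := mean_curvature_vector (M2 f g alpha beta) u v in
  mink H H = mean_curvature_sq 1 alpha beta f g u.
Proof.
intros Hs Hr H; unfold H; clear H.
assert (Hc := cos_sq_sin_sq (alpha * v)).
assert (Hh := cosh_sq_sinh_sq (beta * v)).
apply (mean_curvature_sq_rotational _
  (fun p q => M2 (fun _ => p) (fun _ => q) alpha beta u v)); trivial.
- ring.
- intros p q a b; unfold M2, mink; ring [Hc Hh].
- intros p q; rewrite dv_M2; unfold M2, mink; ring.
- now rewrite du_M2.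
- now rewrite !du_M2.
- rewrite dv_M2; unfold dv, Derive4, M2; simpl.
  destruct (Derive_circular (- alpha * f u) alpha v) as [_ ->].
  destruct (Derive_circular (alpha * f u) alpha v) as [-> _].
  destruct (Derive_hyperbolic (beta * g u) beta v) as [-> ->].
  apply R41_eq; ring.
- unfold gG, rotation_sq; rewrite dv_M2; unfold mink; ring [Hc Hh].
Qed.

(** * Meridians that are graphs *)

(** Up to sign, this is twice the component of [H] along the unit normal in the
meridian plane, for the meridian with second coordinate [u]. *)
Definition graph_curvature (e alpha beta : R) (F : R -> R) (u : R) : R :=
  (Derive (Derive F) u / (1 + e * Derive F u ^ 2)
   - e * ((alpha ^ 2 * F u + beta ^ 2 * u * Derive F u)
          / (alpha ^ 2 * F u ^ 2 - e * beta ^ 2 * u ^ 2)))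
  / sqrt (1 + e * Derive F u ^ 2).

(** The equation [f (phi u) = F u] is known on [J'] only, so differentiating it
at endpoints of [J'] relies on [Derive_eq_on_interval]. *)
Lemma derivatives_of_reparametrization (J' J : R -> Prop) (phi f F : R -> R) :
  is_interval J' -> smooth_on J' phi -> (forall u, J' u -> J (phi u)) ->
  smooth_on J f -> (forall u, J' u -> ex_derive F u) ->
  (forall u, J' u -> ex_derive (Derive F) u) ->
  (forall u, J' u -> f (phi u) = F u) ->
  forall u, J' u ->
  Derive F u = Derive phi u * Derive f (phi u) /\
  Derive (Derive F) u =
    Derive (Derive phi) u * Derive f (phi u)
    + Derive phi u ^ 2 * Derive (Derive f) (phi u).
Proof.
intros hJ' hphi JJ hf dF ddF fF.
assert (dphi : forall u, J' u -> ex_derive phi u).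
{ intros u Ju; now apply (smooth_on_ex_derive J'). }
assert (ddphi : forall u, J' u -> ex_derive (Derive phi) u).
{ intros u Ju; now apply (smooth_on_ex_derive J'); [apply smooth_on_Derive|]. }
assert (df : forall u, J' u -> ex_derive f (phi u)).
{ intros u Ju; apply (smooth_on_ex_derive J); auto. }
assert (ddf : forall u, J' u -> ex_derive (Derive f) (phi u)).
{ intros u Ju; apply (smooth_on_ex_derive J); auto; now apply smooth_on_Derive. }
assert (E1 : forall u, J' u -> Derive F u = Derive phi u * Derive f (phi u)).
{ intros u Ju; rewrite <- Derive_comp; auto.
  apply (Derive_eq_on_interval J'); auto.
  - intros t Jt; symmetry; auto.
  - apply @ex_derive_comp; auto. }
intros u Ju; split; [auto|].
assert (dcomp : ex_derive (fun t => Derive f (phi t)) u).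
{ apply @ex_derive_comp; auto. }
rewrite (Derive_eq_on_interval J' _ (fun t => Derive phi t * Derive f (phi t)));
  auto.
- rewrite Derive_mult, (Derive_comp (Derive f)); auto; ring.
- apply ex_derive_mult; auto.
Qed.

(** [<H, H>] does not depend on the parameter of the meridian: the change of
parameter [phi] multiplies both summands of the curvature by [Derive phi u] and
[speed_sq] by its square, and the second derivative of [phi] cancels. *)
Lemma mean_curvature_sq_graph (J' J : R -> Prop) (phi f g F : R -> R)
    (e alpha beta : R) :
  is_interval J' -> smooth_on J' phi -> (forall u, J' u -> J (phi u)) ->
  smooth_on J f -> smooth_on J g -> smooth_on J' F ->
  (forall u, J' u -> f (phi u) = F u) -> (forall u, J' u -> g (phi u) = u) ->
  (forall t, J t -> 0 < speed_sq e f g t) ->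
  (forall t, J t -> rotation_sq e alpha beta f g t <> 0) ->
  forall u, J' u ->
  0 < 1 + e * Derive F u ^ 2 /\
  mean_curvature_sq e alpha beta f g (phi u) =
    graph_curvature e alpha beta F u ^ 2 / 4.
Proof.
intros hJ' hphi JJ hf hg hF fF gid Hs Hr u Ju.
assert (D1id : forall t, Derive (fun x => x) t = 1) by (intros t; apply Derive_id).
assert (D2id : forall t, Derive (Derive (fun x => x)) t = 0).
{ intros t; rewrite (Derive_ext _ (fun _ => 1)) by exact D1id.
  apply Derive_const. }
destruct (derivatives_of_reparametrization J' J phi f F) with (u := u)
  as [F1 F2]; auto.
{ intros t Jt; now apply (smooth_on_ex_derive J'). }
{ intros t Jt; now apply (smooth_on_ex_derive J'); [apply smooth_on_Derive|]. }
destruct (derivatives_of_reparametrization J' J phi g (fun x => x))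
  with (u := u) as [G1 G2]; auto.
{ intros t Jt; apply ex_derive_id. }
{ intros t Jt; apply (ex_derive_ext (fun _ => 1)).
  - intros x; now rewrite D1id.
  - apply ex_derive_const. }
rewrite D1id in G1; rewrite D2id in G2.
specialize (Hs (phi u) (JJ u Ju)); specialize (Hr (phi u) (JJ u Ju)).
unfold mean_curvature_sq, graph_curvature; unfold speed_sq, rotation_sq in *.
rewrite (fF u Ju), (gid u Ju) in *.
rewrite F1, F2; clear F1 F2 D1id D2id.
set (p := Derive phi u) in *; set (q := Derive (Derive phi) u) in *.
set (a := Derive f (phi u)) in *; set (b := Derive g (phi u)) in *.
set (a2 := Derive (Derive f) (phi u)) in *.
set (b2 := Derive (Derive g) (phi u)) in *.
(* [g] inverts [phi], which expresses both derivatives of [phi] by those of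
   [g]. *)
assert (b0 : b <> 0) by (intros E; rewrite E in G1; lra).
assert (Ep : p = / b) by (apply (Rmult_eq_reg_r b); [rewrite Rinv_l; lra|exact b0]).
assert (Eq : q = - b2 / b ^ 3).
{ apply (Rmult_eq_reg_r b); [|exact b0].
  replace (- b2 / b ^ 3 * b) with (- (/ b) ^ 2 * b2) by (field; exact b0).
  rewrite <- Ep; lra. }
assert (Es : 1 + e * (p * a) ^ 2 = (b ^ 2 + e * a ^ 2) / b ^ 2).
{ rewrite Ep; field; exact b0. }
assert (Hpos : 0 < 1 + e * (p * a) ^ 2).
{ rewrite Es; apply Rdiv_lt_0_compat; [exact Hs|nra]. }
split; [exact Hpos|].
assert (Hdiv : forall n, (n / sqrt (1 + e * (p * a) ^ 2)) ^ 2
                         = n ^ 2 / (1 + e * (p * a) ^ 2)).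
{ intros n; rewrite <- (pow2_sqrt (1 + e * (p * a) ^ 2)) at 2 by lra.
  field; apply Rgt_not_eq, sqrt_lt_R0; lra. }
rewrite Hdiv, Es, Ep, Eq; field; repeat split; auto; lra.
Qed.

Lemma continuity_pt_graph_curvature (e alpha beta : R) (F : R -> R) (u : R) :
  ex_derive F u -> ex_derive (Derive F) u -> ex_derive (Derive (Derive F)) u ->
  0 < 1 + e * Derive F u ^ 2 ->
  alpha ^ 2 * F u ^ 2 - e * beta ^ 2 * u ^ 2 <> 0 ->
  continuity_pt (graph_curvature e alpha beta F) u.
Proof.
intros H0 H1 H2 Hpos Hr; apply ex_derive_continuity_pt.
unfold graph_curvature; set (F2 := Derive (Derive F)) in *.
set (F1 := Derive F) in *; clearbody F2 F1.
auto_derive; repeat split; auto; try lra.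
apply Rgt_not_eq, sqrt_lt_R0; lra.
Qed.

Lemma continuity_pt_mean_curvature_sq (e alpha beta : R) (f g : R -> R) (u : R) :
  ex_derive f u -> ex_derive (Derive f) u -> ex_derive (Derive (Derive f)) u ->
  ex_derive g u -> ex_derive (Derive g) u -> ex_derive (Derive (Derive g)) u ->
  0 < speed_sq e f g u -> rotation_sq e alpha beta f g u <> 0 ->
  continuity_pt (mean_curvature_sq e alpha beta f g) u.
Proof.
intros f0 f1 f2 g0 g1 g2 Hs Hr; apply ex_derive_continuity_pt.
unfold mean_curvature_sq, speed_sq, rotation_sq in *.
set (ddf := Derive (Derive f)) in *; set (ddg := Derive (Derive g)) in *.
set (df := Derive f) in *; set (dg := Derive g) in *.
clearbody ddf ddg df dg.
auto_derive; repeat split; auto; try lra.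
Qed.

Section Meridian.

Variables (e alpha beta : R) (x : R -> R41) (graph : (R -> R) -> R -> R41).
Variables (ode : R -> (R -> R) -> R -> Prop) (f g : R -> R).

Hypothesis x_graph : forall t F u, x t = graph F u <-> f t = F u /\ g t = u.

Hypothesis ode_curvature : forall c F u,
  ex_derive (Derive F) u -> 0 < 1 + e * Derive F u ^ 2 ->
  (ode c F u <-> graph_curvature e alpha beta F u = c).

Variable J : R -> Prop.
Hypothesis hJ : is_interval J.
Hypotheses (hf : smooth_on J f) (hg : smooth_on J g).
Hypothesis speed_pos : forall t, J t -> 0 < speed_sq e f g t.
Hypothesis rotation_nonzero :
  forall t, J t -> rotation_sq e alpha beta f g t <> 0.

Lemma constant_of_determined (c : R) :
  determined_up_to_parametrization J x graph (ode c) ->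
  forall t, J t -> mean_curvature_sq e alpha beta f g t = c ^ 2 / 4.
Proof.
intros (J' & phi & F & hJ' & (hphi & phi' & JJ & surj) & hF & Hx & HF) t Jt.
destruct (surj t Jt) as (u & Ju & <-).
destruct (mean_curvature_sq_graph J' J phi f g F e alpha beta) with (u := u)
  as [Hpos E]; auto.
- intros s Js; apply x_graph; auto.
- intros s Js; apply (x_graph (phi s) F s); auto.
- rewrite E; do 2 f_equal; apply ode_curvature; auto.
  exact (proj1 (proj2 (smooth_on_ex_derive_3 J' F u hF Ju))).
Qed.

(** Where [g] can serve as the parameter, the curvature of the graph is a
continuous square root of [4 * <H, H>], hence constant on the interval. *)
Lemma determined_of_constant (k : R) :
  (forall t, J t -> Derive g t <> 0) -> k <> 0 ->
  (forall t, J t -> mean_curvature_sq e alpha beta f g t = k) ->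
  exists c, c ^ 2 = 4 * k /\
    determined_up_to_parametrization J x graph (ode c).
Proof.
intros g0 k0 Hk.
destruct (parametrization_by_value J g hJ hg g0)
  as (J' & phi & hJ' & hphi & gid).
assert (hphi' := hphi); destruct hphi' as (sphi & phi' & JJ & surj).
set (F := fun u => f (phi u)).
assert (hF : smooth_on J' F) by exact (smooth_on_comp J' J f phi sphi JJ hf).
assert (HF := mean_curvature_sq_graph J' J phi f g F e alpha beta hJ' sphi JJ
                hf hg hF (fun _ _ => eq_refl) gid speed_pos rotation_nonzero).
assert (dF := fun u => smooth_on_ex_derive_3 J' F u hF).
destruct (constant_of_constant_square J' (graph_curvature e alpha beta F) (4 * k))
  as (c & Hc & Ec).
- exact hJ'.
- intros u Ju; destruct (dF u Ju) as (? & ? & ?).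
  apply continuity_pt_graph_curvature; auto.
  + now apply HF.
  + assert (Hr := rotation_nonzero (phi u) (JJ u Ju)).
    unfold rotation_sq in Hr; now rewrite (gid u Ju) in Hr.
- lra.
- intros u Ju; destruct (HF u Ju) as [_ E].
  rewrite Hk in E by auto; lra.
- exists c; split; [exact Hc|].
  exists J', phi, F; split; [exact hJ'|split; [exact hphi|split; [exact hF|]]].
  split; intros u Ju.
  + apply x_graph; split; [reflexivity|auto].
  + apply ode_curvature; [apply (dF u Ju)|now apply HF|auto].
Qed.

End Meridian.

(** The two equations are [graph_curvature = c], multiplied by [sqrt (1 + e *
Derive F u ^ 2)] and, for the first type, by [2]. *)
Lemma ode1_curvature (alpha beta c : R) (F : R -> R) (u : R) :
  ex_derive (Derive F) u -> 0 < 1 + -1 * Derive F u ^ 2 ->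
  (ode1 alpha beta c F u <-> graph_curvature (-1) alpha beta F u = c).
Proof.
intros ddF Hpos.
assert (E : Derive (fun t => ln (Rabs ((1 + Derive F t) / (1 - Derive F t)))) u
            = 2 * (Derive (Derive F) u / (1 + -1 * Derive F u ^ 2))).
{ apply is_derive_unique; set (p := Derive F) in *.
  assert (Hq : 0 < (1 + p u) * / (1 + - p u)).
  { apply Rdiv_lt_0_compat; nra. }
  auto_derive.
  - repeat split; trivial; try lra.
    + nra.
    + apply Rabs_pos_lt; lra.
  - rewrite sign_eq_1, Rabs_pos_eq by lra.
    change (Derive (fun x => p x) u) with (Derive p u).
    field; repeat split; nra. }
unfold ode1, graph_curvature; rewrite E.
replace (1 - Derive F u ^ 2) with (1 + -1 * Derive F u ^ 2) by ring.
replace (alpha ^ 2 * F u ^ 2 + beta ^ 2 * u ^ 2)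
  with (alpha ^ 2 * F u ^ 2 - -1 * beta ^ 2 * u ^ 2) by ring.
assert (Hs : 0 < sqrt (1 + -1 * Derive F u ^ 2)) by (apply sqrt_lt_R0; lra).
split; intros H.
- apply (Rmult_eq_reg_r (sqrt (1 + -1 * Derive F u ^ 2))); [|lra].
  unfold Rdiv at 1; rewrite Rmult_assoc, Rinv_l by lra; lra.
- apply (f_equal (fun y => y * sqrt (1 + -1 * Derive F u ^ 2))) in H.
  unfold Rdiv at 1 in H; rewrite Rmult_assoc, Rinv_l in H by lra; lra.
Qed.

Lemma ode2_curvature (alpha beta c : R) (F : R -> R) (u : R) :
  ex_derive (Derive F) u -> 0 < 1 + 1 * Derive F u ^ 2 ->
  (ode2 alpha beta c F u <-> graph_curvature 1 alpha beta F u = c).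
Proof.
intros ddF Hpos.
assert (E : Derive (fun t => atan (Derive F t)) u
            = Derive (Derive F) u / (1 + 1 * Derive F u ^ 2)).
{ apply is_derive_unique; set (p := Derive F) in *.
  auto_derive; [trivial|].
  change (Derive (fun x => p x) u) with (Derive p u).
  unfold Rsqr; field; repeat split; nra. }
unfold ode2, graph_curvature; rewrite E.
replace (1 + Derive F u ^ 2) with (1 + 1 * Derive F u ^ 2) by ring.
replace (alpha ^ 2 * F u ^ 2 - beta ^ 2 * u ^ 2)
  with (alpha ^ 2 * F u ^ 2 - 1 * beta ^ 2 * u ^ 2) by ring.
assert (Hs : 0 < sqrt (1 + 1 * Derive F u ^ 2)) by (apply sqrt_lt_R0; lra).
split; intros H.
- apply (Rmult_eq_reg_r (sqrt (1 + 1 * Derive F u ^ 2))); [|lra].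
  unfold Rdiv at 1; rewrite Rmult_assoc, Rinv_l by lra; lra.
- apply (f_equal (fun y => y * sqrt (1 + 1 * Derive F u ^ 2))) in H.
  unfold Rdiv at 1 in H; rewrite Rmult_assoc, Rinv_l in H by lra; lra.
Qed.

(** * Surfaces of second type whose meridian has vertical tangents *)

(** If [Derive g] vanished between [a] and [b], then [g] would be constant
there, only the term with [rotation_sq] would remain in the curvature, and
constant curvature would make [rotation_sq] constant, hence also [f]. *)
Lemma dense_nonvanishing_derivative (J : R -> Prop) (f g : R -> R)
    (alpha beta k a b : R) :
  (forall x y t, J x -> J y -> x <= t <= y -> J t) ->
  smooth_on J f -> smooth_on J g -> 0 < alpha -> 0 < beta ->
  (forall t, J t -> 0 < speed_sq 1 f g t) ->
  (forall t, J t -> rotation_sq 1 alpha beta f g t < 0) ->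
  k <> 0 -> (forall t, J t -> mean_curvature_sq 1 alpha beta f g t = k) ->
  J a -> J b -> a < b -> exists u, a < u < b /\ Derive g u <> 0.
Proof.
intros convJ hf hg halpha hbeta Hs Hr k0 Hk Ja Jb ab.
destruct (classic (exists u, a < u < b /\ Derive g u <> 0)) as [H|H];
  [exact H|exfalso].
assert (Jt : forall t, a < t < b -> J t).
{ intros t Ht; apply (convJ a b); auto; lra. }
assert (g0 : forall t, a < t < b -> Derive g t = 0).
{ intros t Ht; destruct (Req_dec (Derive g t) 0) as [E|N]; [exact E|].
  exfalso; apply H; now exists t. }
assert (near : forall t (P : R -> Prop), a < t < b ->
  (forall s, a < s < b -> P s) -> locally t P).
{ intros t P Ht HP; apply (locally_open (fun s => a < s /\ s < b)); auto.
  apply open_and; [apply open_gt|apply open_lt]. }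
assert (gg0 : forall t, a < t < b -> Derive (Derive g) t = 0).
{ intros t Ht; rewrite (Derive_ext_loc _ (fun _ => 0)).
  - apply Derive_const.
  - now apply near. }
set (r := rotation_sq 1 alpha beta f g).
assert (Er : forall t, a < t < b -> 4 * k * r t ^ 2 = beta ^ 4 * g t ^ 2).
{ intros t Ht; assert (E := Hk t (Jt t Ht)).
  assert (Hs' := Hs t (Jt t Ht)); assert (Hr' := Hr t (Jt t Ht)).
  unfold mean_curvature_sq in E; fold r in E, Hr'; unfold speed_sq in *.
  rewrite (g0 t Ht), (gg0 t Ht) in *.
  assert (f0 : Derive f t <> 0) by (intros E0; rewrite E0 in Hs'; lra).
  rewrite <- E; field; repeat split; try lra; exact f0. }
assert (df : forall t, a < t < b -> ex_derive f t).
{ intros t Ht; apply (smooth_on_ex_derive J); auto. }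
assert (dg : forall t, a < t < b -> ex_derive g t).
{ intros t Ht; apply (smooth_on_ex_derive J); auto. }
(* Differentiate [Er]: the right-hand side is constant, and the derivative of
   [r] is a multiple of [f * Derive f]. *)
assert (f0 : forall t, a < t < b -> f t = 0).
{ intros t Ht; assert (Hs' := Hs t (Jt t Ht)); assert (Hr' := Hr t (Jt t Ht)).
  assert (E : Derive (fun s => 4 * k * r s ^ 2) t
              = Derive (fun s => beta ^ 4 * g s ^ 2) t).
  { apply Derive_ext_loc; now apply near. }
  assert (L : is_derive (fun s => 4 * k * r s ^ 2) t
                (4 * k * (2 * r t * (2 * alpha ^ 2 * f t * Derive f t
                                     - 2 * beta ^ 2 * g t * Derive g t)))).
  { unfold r, rotation_sq; auto_derive; [repeat split; auto|].
    change (Derive (fun x => f x) t) with (Derive f t).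
    change (Derive (fun x => g x) t) with (Derive g t); ring. }
  assert (K : is_derive (fun s => beta ^ 4 * g s ^ 2) t
                (beta ^ 4 * (2 * g t * Derive g t))).
  { auto_derive; [auto|].
    change (Derive (fun x => g x) t) with (Derive g t); ring. }
  apply is_derive_unique in L, K.
  assert (E0 := eq_trans (eq_sym L) (eq_trans E K)); rewrite g0 in E0 by auto.
  unfold speed_sq in Hs'; rewrite g0 in Hs' by auto; fold (r t) in Hr'.
  assert (E' : (k * r t * alpha ^ 2 * Derive f t) * f t = 0) by lra.
  apply Rmult_integral in E'; destruct E' as [E'|E']; [exfalso|exact E'].
  repeat (apply Rmult_integral in E'; destruct E' as [E'|E']); try lra.
  rewrite E' in Hs'; lra. }
set (t := (a + b) / 2); assert (Ht : a < t < b) by (unfold t; lra).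
assert (Hs' := Hs t (Jt t Ht)); unfold speed_sq in Hs'.
rewrite g0, (Derive_ext_loc f (fun _ => 0)), Derive_const in Hs' by auto.
lra.
Qed.

Lemma constant_of_dense (J P : R -> Prop) (q : R -> R) (k : R) :
  is_interval J -> (forall t, J t -> continuity_pt q t) ->
  (forall x y, J x -> J y -> x < y -> exists u, x < u < y /\ P u) ->
  (forall u, J u -> P u -> q u = k) -> forall t, J t -> q t = k.
Proof.
intros hJ cq dense Hq t Jt.
destruct (Req_dec (q t) k) as [E|N]; [exact E|exfalso].
assert (Hpos : 0 < Rabs (q t - k)) by (apply Rabs_pos_lt; lra).
destruct (cq t Jt _ Hpos) as (d & Hd & Hc).
destruct (interval_near J t d hJ Jt Hd) as (s & Js & st & sd).
assert (exists u, Rmin s t < u < Rmax s t /\ P u) as (u & Hu & Pu).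
{ destruct (Rlt_le_dec s t) as [H|H].
  - rewrite Rmin_left, Rmax_right by lra; auto.
  - rewrite Rmin_right, Rmax_left by lra; apply dense; auto; lra. }
assert (Ju : J u).
{ destruct hJ as [_ convJ]; revert Hu; unfold Rmin, Rmax.
  destruct Rle_dec; intros Hu; [apply (convJ s t)|apply (convJ t s)]; auto; lra. }
assert (ut : Rabs (u - t) < d /\ t <> u).
{ apply Rabs_def2 in sd; revert Hu; unfold Rmin, Rmax; destruct Rle_dec;
    intros Hu; (split; [apply Rabs_def1|]); lra. }
assert (C := Hc u); simpl in C; unfold Rdist in C.
rewrite (Hq u Ju Pu), (Rabs_minus_sym k) in C.
apply (Rlt_irrefl (Rabs (q t - k))), C.
split; [split; [exact I|apply ut]|apply ut].
Qed.

Lemma interval_around (J : R -> Prop) (q : R -> R) (t : R) :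
  is_interval J -> continuity_pt q t -> J t -> q t <> 0 ->
  exists I : R -> Prop,
    is_interval I /\ (forall s, I s -> J s) /\ (forall s, I s -> q s <> 0) /\ I t.
Proof.
intros hJ cq Jt q0.
assert (N : locally t (fun s => q s <> 0)).
{ exact (proj1 (continuity_pt_filterlim q t) cq _ (open_neq 0 _ q0)). }
destruct N as [[d dpos] Hd]; simpl in Hd.
exists (fun s => J s /\ t - d < s < t + d).
assert (hJ' := hJ); destruct hJ' as [_ convJ].
repeat split.
- destruct (interval_near J t d hJ Jt dpos) as (y & Jy & yt & yd).
  apply Rabs_def2 in yd.
  destruct (Rlt_le_dec y t) as [H|H].
  + exists y, t; repeat split; auto; lra.
  + exists t, y; repeat split; auto; lra.
- destruct H as [Ja _], H0 as [Jb _]; apply (convJ a b); auto.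
- lra.
- lra.
- now intros s [Js _].
- intros s [_ Hs]; apply Hd.
  unfold ball; simpl; unfold AbsRing_ball, abs, minus, plus, opp; simpl.
  apply Rabs_def1; lra.
- exact Jt.
- lra.
- lra.
Qed.

Lemma meridian1_graph (f g : R -> R) (t : R) (F : R -> R) (u : R) :
  meridian1 f g t = meridian1 F (fun s => s) u <-> f t = F u /\ g t = u.
Proof.
unfold meridian1; split; [intros E; injection E; auto|now intros [-> ->]].
Qed.

Lemma meridian2_graph (f g : R -> R) (t : R) (F : R -> R) (u : R) :
  meridian2 f g t = meridian2 F (fun s => s) u <-> f t = F u /\ g t = u.
Proof.
unfold meridian2; split; [intros E; injection E; auto|now intros [-> ->]].
Qed.

(** The surfaces enter through the value [q] of [<H, H>], which does not depend
on [v]. *)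
Lemma nonzero_constant_mean_curvature_iff (J : R -> Prop) (z : surface)
    (q : R -> R) :
  (forall u v, J u ->
     mink (mean_curvature_vector z u v) (mean_curvature_vector z u v) = q u) ->
  nonzero_constant_mean_curvature J z <->
  exists k, k <> 0 /\ forall u, J u -> q u = k.
Proof.
intros Hq; split; intros (k & k0 & Hk); exists k; split; auto.
- intros u Ju; rewrite <- (Hq u 0 Ju); apply Hk; auto.
  assert (H := PI_RGT_0); lra.
- intros u v Ju _; rewrite Hq; auto.
Qed.

Theorem theorem7p1 (J : R -> Prop) (f g : R -> R) (alpha beta : R)
    (hJ : is_interval J) (hf : smooth_on J f) (hg : smooth_on J g)
    (halpha : 0 < alpha) (hbeta : 0 < beta) :
  (M1_conditions J f g alpha beta ->
   free_of_inflection_points J (M1 f g alpha beta) ->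
   (nonzero_constant_mean_curvature J (M1 f g alpha beta) <->
    meridian1_determined J f g alpha beta)) /\
  (M2_conditions J f g alpha beta ->
   free_of_inflection_points J (M2 f g alpha beta) ->
   ((forall u, J u -> Derive g u <> 0) ->
    (nonzero_constant_mean_curvature J (M2 f g alpha beta) <->
     meridian2_determined J f g alpha beta)) /\
   (nonzero_constant_mean_curvature J (M2 f g alpha beta) <->
    meridian2_piecewise_determined J f g alpha beta)).
Proof.
split; intros hM _.
- assert (Hs : forall t, J t -> 0 < speed_sq (-1) f g t).
  { intros t Jt; destruct (hM t Jt); unfold speed_sq; lra. }
  assert (Hr : forall t, J t -> rotation_sq (-1) alpha beta f g t <> 0).
  { intros t Jt; destruct (hM t Jt); unfold rotation_sq; lra. }
  rewrite (nonzero_constant_mean_curvature_iff J _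
             (mean_curvature_sq (-1) alpha beta f g)).
  2: { intros u v Ju; apply mean_curvature_sq_M1; auto. }
  split.
  + intros (k & k0 & Hk).
    destruct (determined_of_constant (-1) alpha beta _ _ _ f g
                (meridian1_graph f g) (ode1_curvature alpha beta) J hJ hf hg
                Hs Hr k) as (c & Hc & Hdet); auto.
    * (* The meridian is timelike, so its fourth coordinate is a parameter. *)
      intros t Jt E; destruct (hM t Jt) as [H _]; rewrite E in H; nra.
    * exists c; split; [|exact Hdet].
      intros E; apply k0; rewrite E in Hc; lra.
  + intros (c & c0 & Hdet); exists (c ^ 2 / 4); split.
    * assert (H := pow_nonzero c 2 c0); lra.
    * exact (constant_of_determined (-1) alpha beta _ _ _ f g
               (meridian1_graph f g) (ode1_curvature alpha beta) J hf hg
               Hs Hr c Hdet).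
- assert (Hs : forall t, J t -> 0 < speed_sq 1 f g t).
  { intros t Jt; destruct (hM t Jt); unfold speed_sq; lra. }
  assert (Hr' : forall t, J t -> rotation_sq 1 alpha beta f g t < 0).
  { intros t Jt; destruct (hM t Jt); unfold rotation_sq; lra. }
  assert (Hr : forall t, J t -> rotation_sq 1 alpha beta f g t <> 0).
  { intros t Jt; specialize (Hr' t Jt); lra. }
  rewrite (nonzero_constant_mean_curvature_iff J _
             (mean_curvature_sq 1 alpha beta f g)).
  2: { intros u v Ju; apply mean_curvature_sq_M2; auto. }
  split; [intros g0; split|split].
  + intros (k & k0 & Hk).
    destruct (determined_of_constant 1 alpha beta _ _ _ f g
                (meridian2_graph f g) (ode2_curvature alpha beta) J hJ hf hg
                Hs Hr k) as (c & Hc & Hdet); auto.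
    exists c; split; [|exact Hdet].
    intros E; apply k0; rewrite E in Hc; lra.
  + intros (c & c0 & Hdet); exists (c ^ 2 / 4); split.
    * assert (H := pow_nonzero c 2 c0); lra.
    * exact (constant_of_determined 1 alpha beta _ _ _ f g
               (meridian2_graph f g) (ode2_curvature alpha beta) J hf hg
               Hs Hr c Hdet).
  + intros (k & k0 & Hk); split.
    { intros a b Ja Jb ab; apply (dense_nonvanishing_derivative J f g alpha beta k);
        auto; apply hJ. }
    assert (kpos : 0 < k).
    { destruct hJ as [(a & _ & _ & Ja & _) _].
      assert (H : 0 <= k); [|lra].
      rewrite <- (Hk a Ja); unfold mean_curvature_sq, Rdiv at 1.
      apply Rmult_le_pos; [apply pow2_ge_0|].
      assert (H := Hs a Ja); apply Rlt_le, Rinv_0_lt_compat; lra. }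
    (* On each piece [c' ^ 2 = 4 * k], which fixes [c'] up to sign. *)
    exists (sqrt (4 * k)); split.
    { apply Rgt_not_eq, sqrt_lt_R0; lra. }
    intros I hI IJ g0.
    destruct (determined_of_constant 1 alpha beta _ _ _ f g
                (meridian2_graph f g) (ode2_curvature alpha beta) I hI
                (smooth_on_subset I J f IJ hf) (smooth_on_subset I J g IJ hg)
                (fun t It => Hs t (IJ t It)) (fun t It => Hr t (IJ t It)) k)
      as (c & Hc & Hdet); auto.
    exists c; split; [|exact Hdet].
    assert (Hsq := pow2_sqrt (4 * k) ltac:(lra)).
    assert (E : (c - sqrt (4 * k)) * (c + sqrt (4 * k)) = 0) by nra.
    apply Rmult_integral in E; lra.
  + intros (dense & c & c0 & Hdet); exists (c ^ 2 / 4); split.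
    { assert (H := pow_nonzero c 2 c0); lra. }
    (* [<H, H>] is known where [Derive g] does not vanish, by applying the
       description to a small interval around such a point. *)
    apply (constant_of_dense J (fun u => Derive g u <> 0)); auto.
    { intros t Jt; destruct (smooth_on_ex_derive_3 J f t hf Jt) as (? & ? & ?).
      destruct (smooth_on_ex_derive_3 J g t hg Jt) as (? & ? & ?).
      apply continuity_pt_mean_curvature_sq; auto. }
    intros u Ju gu.
    destruct (interval_around J (Derive g) u) as (I & hI & IJ & g0 & Iu); auto.
    { apply ex_derive_continuity_pt, (smooth_on_ex_derive_3 J g u hg Ju). }
    destruct (Hdet I hI IJ g0) as (c' & Hc' & Hdet').
    rewrite (constant_of_determined 1 alpha beta _ _ _ f g
               (meridian2_graph f g) (ode2_curvature alpha beta) I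
               (smooth_on_subset I J f IJ hf) (smooth_on_subset I J g IJ hg)
               (fun t It => Hs t (IJ t It)) (fun t It => Hr t (IJ t It))
               c' Hdet' u Iu).
    destruct Hc' as [-> | ->]; field.
Qed.
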